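(* Let $\alpha,\beta$ be irrational, let $U,V\subset\mathbb S^1$ be open sets and $x_0,y_0\in\mathbb S^1$. Suppose that the word $W_1$ generated by the dynamics $(\mathbb S^1,T_\alpha,U,x_0)$ and the word $W_2$ generated by the dynamics $(\mathbb S^1,T_\beta,V,y_0)$ coincide. Then there exist (nonzero) integers $p$ and $q$ such that the sets $U$ and $V$, after the corresponding multiplications, coincide up to a rotation, i.e. $U_p=T_\delta(V_q)$ for some $\delta>0$.
   Context: $\mathbb S^1=\mathbb R/\mathbb Z$ is the circle of unit length and $T_\alpha:x\mapsto x+\alpha \pmod 1$ is the rotation by $\alpha$. The dynamics $(\mathbb S^1,T_\alpha,U,x_0)$ generates the (two-sided infinite) word $W=(w_n)_{n\in\mathbb Z}$ over a binary alphabet $\{a,b\}$ given by $w_n=a$ if $T_\alpha^{n}(x_0)\in U$ and $w_n=b$ if $T_\alpha^{n}(x_0)\notin U$ (the trajectory of the initial point being assumed not to hit the boundary $\partial U$). For integers $q\neq 0$ and $r$, put $\gamma=\alpha/q+r/q$, $U_q=\{x\in\mathbb S^1 : qx\in U\}$ and $z_0=x_0/q$; the dynamics $(\mathbb S^1,T_\gamma,U_q,z_0)$ generates the same word as $(\mathbb S^1,T_\alpha,U,x_0)$, and the passage from the latter dynamics to the former is called $q$-multiplication. The integers $p,q$ may be of either sign.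
   Formalization: For arbitrary open U, V the equality U_p = T_δ(V_q) can fail (U the circle, V the circle minus a point off the orbit); it is proved at all points off the boundaries of the two sets, and as literal equality when U and V are regular open (each the interior of its closure). *)

(* Defs.v *)
From HB Require Import structures.
From mathcomp Require Import all_boot all_order all_algebra generic_quotient.
From mathcomp Require Import archimedean ring_quotient.
From mathcomp Require Import all_classical all_reals all_analysis.
Import Order.TTheory GRing.Theory Num.Theory.
Import numFieldNormedType.Exports.

Set Implicit Arguments.
Unset Strict Implicit.
Unset Printing Implicit Defensive.

Local Open Scope classical_set_scope.
Local Open Scope ring_scope.
Local Open Scope quotient_scope.

Definition integers (R : realType) : zmodClosed R :=
  GRing.ZmodClosed.clone R (@Num.int_num_subdef R) _.

(* [{ideal_quot I}] is the quotient of a Z-module by any subgroup [I]; only its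
   ring structure needs an ideal.  This is R/Z with the quotient topology: a set
   is open iff its preimage in R is. *)
Definition circle (R : realType) : Type :=
  quotient_topology {ideal_quot (integers R)}.

HB.instance Definition _ (R : realType) := Topological.on (circle R).
HB.instance Definition _ (R : realType) := Quotient.on (circle R).

(* The group structure of the quotient; rebuilt rather than copied so that it
   lies over the same equality and choice structures as the topology. *)
HB.instance Definition _ (R : realType) :=
  @GRing.isZmodule.Build (circle R) 0 -%R +%R
    (@addrA {ideal_quot (integers R)}) (@addrC {ideal_quot (integers R)})
    (@add0r {ideal_quot (integers R)}) (@addNr {ideal_quot (integers R)}).

Definition circle_pi (R : realType) (t : R) : circle R := \pi_(circle R) t.

Lemma circle_piB (R : realType) : {morph @circle_pi R : s t / s - t}.
Proof.
move=> s t; rewrite /circle_pi.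
exact: (@pi_is_zmod_morphism R _ _ {ideal_quot (integers R)}).
Qed.

Lemma circle_pi_eq (R : realType) (s t : R) :
  circle_pi s = circle_pi t <-> s - t \is a Num.int.
Proof.
have E : (s - t \is a Num.int) = (s == t %[mod {ideal_quot (integers R)}]).
  exact: (Quotient.idealrBE (integers R)).
by rewrite E; split => [h|/eqP h]; [apply/eqP; exact: h | exact: h].
Qed.

Lemma circle_pi_surj (R : realType) (x : circle R) : exists t, circle_pi t = x.
Proof. by exists (repr x); exact: reprK. Qed.

Lemma circle_openE (R : realType) (U : set (circle R)) :
  open U = open (@circle_pi R @^-1` U).
Proof. by []. Qed.

Definition rotation (R : realType) (alpha : R) (x : circle R) : circle R :=
  x + circle_pi alpha.

(* [rotation (- alpha)] is the inverse of [rotation alpha]. *)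
Definition rotation_iter (R : realType) (alpha : R) (n : int) (x : circle R) :
    circle R :=
  match n with
  | Posz k => iter k (rotation alpha) x
  | Negz k => iter k.+1 (rotation (- alpha)) x
  end.

Definition boundary (T : topologicalType) (A : set T) : set T :=
  closure A `\` A°.

Inductive letter := letter_a | letter_b.

Definition word (R : realType) (alpha : R) (U : set (circle R))
    (x0 : circle R) : int -> letter :=
  fun n => if rotation_iter alpha n x0 \in U then letter_a else letter_b.

Definition avoids_boundary (R : realType) (alpha : R) (U : set (circle R))
    (x0 : circle R) : Prop :=
  forall n : int, ~ boundary U (rotation_iter alpha n x0).

(* The set written U_q. *)
Definition multiply (R : realType) (q : int) (U : set (circle R)) :
    set (circle R) :=
  [set x | U (x *~ q)].

(* A word generated by a trajectory avoiding the boundary carries no information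
   on it: removing from an open set a point off the trajectory leaves the word
   unchanged.  So for arbitrary open sets equality can only be asserted in this
   sense; for regular open sets ([regopen]) there is no such ambiguity. *)
Definition agree_off_boundary (T : topologicalType) (A B : set T) : Prop :=
  forall x, ~ boundary A x -> ~ boundary B x -> (A x <-> B x).

(* Main.v *)
Require Import Defs.
From HB Require Import structures.
From mathcomp Require Import all_boot all_order all_algebra.
From mathcomp Require Import all_classical all_reals all_analysis.
From mathcomp Require Import ring lra.
Import Order.TTheory GRing.Theory Num.Theory.
Import numFieldNormedType.Exports.
Local Open Scope classical_set_scope.
Local Open Scope ring_scope.

(** The pair of points [(x0 + n alpha, y0 + n beta)] moves on the two-torus, and
    equality of the words says that it never enters [U x (complement of V)] or
    [(complement of U) x V]. Two cases arise, according to whether [alpha] and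
    [beta] satisfy an integral relation [k alpha + l beta = m] with [(k, l)] not
    [(0, 0)].

    Without such a relation the orbit is dense in the torus
    ([orbit_pair_dense]), so it would enter the open set
    [U x (complement of the closure of V)] if that set were nonempty. Hence each
    of [U], [V] lies in the closure of the other, and [p = q = 1] works.

    With such a relation, both [k] and [l] are nonzero because [alpha] and
    [beta] are irrational. Take [p = l] and [q = - k]. The rotation by [alpha]
    itself lies above both systems: multiplied by [p] it is [l] steps of
    [alpha], and multiplied by [q] it is the rotation by
    [- k alpha = l beta - m], that is, [l] steps of [beta]. So, if [p x = x0]
    and [q y = y0], the point [x + n alpha] belongs to [U_p] exactly when
    [y + n alpha] belongs to [V_q], which is to say that [x + n alpha] belongs
    to the translate of [V_q] by [x - y]. This single orbit is dense in the
    circle ([orbit_dense]), so the two sets are each in the closure of the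
    other.

    In both cases two open sets lie in each other's closures. This forces
    agreement off the boundaries ([mutual_closure_agree]), and equality when the
    two sets are regular open ([mutual_closure_regopen_eq]); regularity passes
    from [U] and [V] to their multiplications because [x -> (x + c) q] is
    continuous and open ([regopen_preimage]). *)

(** * Simultaneous approximation *)

Lemma irrational_int_mul {R : realType} {a : R} {n k : int} :
  irrational a -> n%:~R * a = k%:~R -> n = 0.
Proof.
move=> airr ank; apply/eqP/negPn/negP => n0; apply: airr.
exists (k%:~R / n%:~R) => //.
rewrite fmorph_div /= !ratr_int -ank mulrC mulKf //.
by rewrite intr_eq0.
Qed.

Lemma trunc_eq_dist {R : realType} (s t : R) :
  0 <= s -> 0 <= t -> Num.trunc s = Num.trunc t -> `|s - t| < 1.
Proof.
move=> s0 t0 st.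
have /andP[s1 s2] := truncn_itv s0; have /andP[t1 t2] := truncn_itv t0.
rewrite st in s1 s2; rewrite -natr1 in s2 t2; rewrite ltr_norml; lra.
Qed.

(** Pigeonhole: the fractional parts of the pairs [(i a, i b)], for [i] from
    [0] to [K ^ 2], fall in [K ^ 2] square cells of side [1 / K], so two of the
    pairs share a cell; [n] is the difference of the two indices. *)
Lemma dirichlet_pair {R : realType} (a b e : R) : 0 < e ->
  exists n k l : int,
    [/\ n != 0, `|n%:~R * a - k%:~R| < e & `|n%:~R * b - l%:~R| < e].
Proof.
move=> e0; set M := Num.bound e^-1.
(* The number K of cells in each direction is M.+1, positive for every M. *)
have Me : e^-1 < M.+1%:R.
  apply: lt_trans (archi_boundP _) _; first by rewrite invr_ge0 ltW.
  by rewrite ltr_nat.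
have M0 : (0 : R) < M.+1%:R by rewrite ltr0n.
pose fr (t : R) := t - (Num.floor t)%:~R.
have fr0 t : 0 <= M.+1%:R * fr t.
  by rewrite mulr_ge0 ?ler0n // subr_ge0 floor_le.
have frM t : (Num.trunc (M.+1%:R * fr t) < M.+1)%N.
  rewrite truncn_lt_nat // -[ltRHS]mulr1 ltr_pM2l // /fr ltrBlDr addrC.
  by have /andP[_] := floor_itv t; rewrite intrD.
pose cell t : 'I_M.+1 := Ordinal (frM t).
have cell_close s t : cell s = cell t -> `|fr s - fr t| < e.
  move=> /(congr1 val)/= /(trunc_eq_dist _ _ (fr0 s) (fr0 t)).
  rewrite -mulrBr normrM gtr0_norm // -ltr_pdivlMl // mulr1 => /lt_trans; apply.
  by rewrite invf_plt ?posrE.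
pose f (i : 'I_((M.+1 * M.+1).+1)) := (cell (i%:R * a), cell (i%:R * b)).
have /injectivePn[i [j ij fij]] : ~~ injectiveb f.
  apply/negP => /injectiveP /leq_card.
  by rewrite card_prod !card_ord ltnn.
have fa := cell_close _ _ (congr1 fst fij).
have fb := cell_close _ _ (congr1 snd fij).
pose fl (c : R) := Num.floor (i%:R * c) - Num.floor (j%:R * c).
exists (i%:Z - j%:Z), (fl a), (fl b).
have frE c : (i%:Z - j%:Z)%:~R * c - (fl c)%:~R = fr (i%:R * c) - fr (j%:R * c).
  rewrite /fl /fr !intrB -!pmulrn; ring.
by split; rewrite ?frE // subr_eq0 eqz_nat.
Qed.

Lemma floor_dist {R : realType} (r s : R) : `|r * s - (Num.floor r)%:~R * s| <= `|s|.
Proof.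
rewrite -mulrBl normrM ler_piMl // ger0_norm ?subr_ge0 ?floor_le //.
by rewrite lerBlDr addrC ltW //; have /andP[_] := floor_itv r; rewrite intrD.
Qed.

(** The multiples of a small nonzero [s = n a - k] come within [|s|] of any real;
    irrationality is what makes [s] nonzero. *)
Lemma kronecker {R : realType} (a x e : R) : irrational a -> 0 < e ->
  exists n k : int, `|x - (n%:~R * a + k%:~R)| < e.
Proof.
move=> airr e0; have [n [k [_ [n0 nk _]]]] := dirichlet_pair a a e e0.
set s := n%:~R * a - k%:~R in nk.
have s0 : s != 0.
  by rewrite subr_eq0; apply: contra_neq n0 => /(irrational_int_mul airr).
pose N := Num.floor (x / s).
exists (N * n), (- (N * k)).
have -> : x - ((N * n)%:~R * a + (- (N * k))%:~R) = x / s * s - N%:~R * s.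
  rewrite divfK // /s mulrNz !intrM; ring.
exact: le_lt_trans (floor_dist _ _) nk.
Qed.

(** Dirichlet's argument gives a short vector [(s, t)] congruent to a multiple of
    [(a, b)] modulo integers. Its multiples follow the line it spans closely, and
    this line has irrational slope, by independence; hence it is dense in the
    torus, by the one-dimensional case applied to the slope. *)
Lemma kronecker_pair {R : realType} (a b x y e : R) :
  (forall k l m : int, k%:~R * a + l%:~R * b = m%:~R -> k = 0 /\ l = 0) ->
  0 < e ->
  exists n k l : int, `|x - (n%:~R * a + k%:~R)| < e /\
                      `|y - (n%:~R * b + l%:~R)| < e.
Proof.
move=> indep e0.
have e20 : 0 < e / 2 by rewrite divr_gt0.
have [n [k [l [n0 nk nl]]]] := dirichlet_pair a b (e / 2) e20.
set s := n%:~R * a - k%:~R in nk; set t := n%:~R * b - l%:~R in nl.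
have s0 : s != 0.
  apply: contra_neq n0 => s0; have [] // := indep n 0 k.
  by move/eqP: s0; rewrite subr_eq0 => /eqP ->; rewrite mul0r addr0.
have slope_irr : irrational (t / s).
  move=> [r _ rE].
  have d0 := denq_neq0 r.
  have rel : (denq r)%:~R * t = (numq r)%:~R * s.
    have dR : (denq r)%:~R != 0 :> R by rewrite intr_eq0.
    have rR : ratr r = (numq r)%:~R / (denq r)%:~R :> R by [].
    by rewrite -[t](divfK s0) -rE rR mulrA [_ * (_ / _)]mulrC divfK.
  have int_rel : (- (numq r * n))%:~R * a + (denq r * n)%:~R * b =
      (denq r * l - numq r * k)%:~R.
    by rewrite mulrNz intrB !intrM; move: rel; rewrite /s /t; lra.
  have [_ /eqP] := indep _ _ _ int_rel.
  by rewrite mulf_eq0 (negPf d0) (negPf n0).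
(* The point of the line with abscissa x + m has ordinate x * t / s + m * t / s,
   to be brought close to y modulo integers. *)
have [m [j mj]] := kronecker (t / s) (y - x / s * t) (e / 2) slope_irr e20.
pose r := (x + m%:~R) / s.
pose N := Num.floor r.
exists (N * n), (- (N * k) - m), (- (N * l) + j); split.
  have -> : x - ((N * n)%:~R * a + (- (N * k) - m)%:~R) = r * s - N%:~R * s.
    rewrite /r divfK // /s intrB mulrNz !intrM; ring.
  by apply: le_lt_trans (floor_dist _ _) (lt_trans nk _); lra.
have -> : y - ((N * n)%:~R * b + (- (N * l) + j)%:~R) =
    (r * t - N%:~R * t) + (y - x / s * t - (m%:~R * (t / s) + j%:~R)).
  rewrite /r /t intrD mulrNz !intrM; field.
  exact: s0.
have := ler_normD (r * t - N%:~R * t)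
  (y - x / s * t - (m%:~R * (t / s) + j%:~R)).
have := floor_dist r t; rewrite -/N; lra.
Qed.

(** * The circle as a divisible group *)

HB.instance Definition _ (R : realType) :=
  GRing.isZmodMorphism.Build R (circle R) (@circle_pi R) (@circle_piB R).

Lemma circle_piDint {R : realType} (t : R) (m : int) :
  circle_pi (t + m%:~R) = circle_pi t.
Proof. by apply/circle_pi_eq; rewrite addrAC subrr add0r intr_int. Qed.

Lemma circle_piD {R : realType} (s t : R) :
  circle_pi (s + t) = circle_pi s + circle_pi t.
Proof. exact: raddfD. Qed.

Lemma circle_piMz {R : realType} (t : R) (n : int) :
  circle_pi (n%:~R * t) = circle_pi t *~ n.
Proof. by rewrite mulrzl raddfMz. Qed.

Lemma circle_divisible {R : realType} (n : int) (x : circle R) :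
  n != 0 -> exists y : circle R, y *~ n = x.
Proof.
move=> n0; have [t <-] := circle_pi_surj x.
exists (circle_pi (t / n%:~R)).
by rewrite -circle_piMz mulrC divfK // intr_eq0.
Qed.

Lemma circle_pi_pos_lift {R : realType} (x : circle R) :
  exists2 t : R, 0 < t & circle_pi t = x.
Proof.
have [t <-] := circle_pi_surj x.
exists (t + (1 - Num.floor t)%:~R); last exact: circle_piDint.
by rewrite intrB addrCA ltr_wpDr // subr_ge0 floor_le.
Qed.

Lemma rotation_iterE {R : realType} (alpha : R) (n : int) (x : circle R) :
  rotation_iter alpha n x = x + circle_pi alpha *~ n.
Proof.
have iterE (c : R) (k : nat) : iter k (rotation c) x = x + circle_pi c *+ k.
  elim: k => [|k IH]; first by rewrite addr0.
  by rewrite iterS IH /rotation mulrSr addrA.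
by case: n => k; rewrite /rotation_iter iterE // raddfN mulNrn NegzE mulrNz.
Qed.

Lemma rotation_imageE {R : realType} (delta : R) (A : set (circle R)) :
  rotation delta @` A = [set x | A (x - circle_pi delta)].
Proof.
apply/seteqP; split => [_ [x Ax <-]|x Ax] /=; first by rewrite /rotation addrK.
by exists (x - circle_pi delta); rewrite // /rotation subrK.
Qed.

(** * Density of orbits *)

Lemma circle_open_ball {R : realType} {U : set (circle R)} {t : R} :
  open U -> U (circle_pi t) ->
  exists2 e : R, 0 < e & forall s, `|t - s| < e -> U (circle_pi s).
Proof.
rewrite circle_openE => oU Ut.
have /nbhs_ballP[e /= e0 eU] := open_nbhs_nbhs (conj oU Ut).
by exists e => // s ts; apply: eU.
Qed.

Lemma orbit_dense {R : realType} (alpha : R) (U : set (circle R))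
    (x : circle R) :
  irrational alpha -> open U -> U !=set0 ->
  exists n : int, U (x + circle_pi alpha *~ n).
Proof.
move=> airr oU [u Uu].
have [s sE] := circle_pi_surj x; have [t tE] := circle_pi_surj (u - x).
have Ust : U (circle_pi (s + t)) by rewrite circle_piD sE tE addrC subrK.
have [e e0 eU] := circle_open_ball oU Ust.
have [n [k nk]] := kronecker alpha t e airr e0.
exists n; rewrite -sE -circle_piMz -circle_piD -(circle_piDint _ k); apply: eU.
by have -> : s + t - (s + n%:~R * alpha + k%:~R) =
  t - (n%:~R * alpha + k%:~R) by ring.
Qed.

Lemma orbit_pair_dense {R : realType} (alpha beta : R) (U V : set (circle R))
    (x y : circle R) :
  (forall k l m : int, k%:~R * alpha + l%:~R * beta = m%:~R ->
     k = 0 /\ l = 0) ->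
  open U -> open V -> U !=set0 -> V !=set0 ->
  exists n : int, U (x + circle_pi alpha *~ n) /\ V (y + circle_pi beta *~ n).
Proof.
move=> indep oU oV [u Uu] [v Vv].
have [s sE] := circle_pi_surj x; have [t tE] := circle_pi_surj (u - x).
have [s' s'E] := circle_pi_surj y; have [t' t'E] := circle_pi_surj (v - y).
have Ust : U (circle_pi (s + t)) by rewrite circle_piD sE tE addrC subrK.
have Vst : V (circle_pi (s' + t')) by rewrite circle_piD s'E t'E addrC subrK.
have [e e0 eU] := circle_open_ball oU Ust.
have [d d0 dV] := circle_open_ball oV Vst.
have m0 : 0 < Num.min e d by rewrite lt_min e0.
have [n [k [l [nk nl]]]] := kronecker_pair alpha beta t t' _ indep m0.
exists n; split.
- rewrite -sE -circle_piMz -circle_piD -(circle_piDint _ k); apply: eU.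
  have -> : s + t - (s + n%:~R * alpha + k%:~R) =
    t - (n%:~R * alpha + k%:~R) by ring.
  apply: lt_le_trans nk _.
  by rewrite ge_min lexx.
- rewrite -s'E -circle_piMz -circle_piD -(circle_piDint _ l); apply: dV.
  have -> : s' + t' - (s' + n%:~R * beta + l%:~R) =
    t' - (n%:~R * beta + l%:~R) by ring.
  apply: lt_le_trans nl _.
  by rewrite ge_min lexx orbT.
Qed.

(** * Affine maps of the circle are continuous and open *)

Lemma affine_open_preimage {R : realType} (c : circle R) (q : int)
    (V : set (circle R)) :
  open V -> open [set x : circle R | V ((x + c) *~ q)].
Proof.
have [s <-] := circle_pi_surj c.
rewrite !circle_openE => oV.
pose g (t : R) := q%:~R * (t + s).
have gc : continuous g.
  move=> t; apply: cvgM; first exact: cvg_cst.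
  by apply: cvgD; [exact: cvg_id|exact: cvg_cst].
have -> : @circle_pi R @^-1` [set x | V ((x + circle_pi s) *~ q)] =
    g @^-1` (@circle_pi R @^-1` V).
  by apply/funext => t /=; rewrite /g circle_piMz circle_piD.
by apply: open_comp => // t _; exact: gc.
Qed.

(** A real [t] lies above the image exactly when, for some integer [m], the real
    [(t - m) / q - s] lies above [W], where [s] lifts [c]: these are the branches
    of the inverse map, each of them continuous. *)
Lemma affine_open_image {R : realType} (c : circle R) (q : int)
    (W : set (circle R)) :
  q != 0 -> open W -> open [set (x + c) *~ q | x in W].
Proof.
move=> q0; have [s <-] := circle_pi_surj c.
rewrite !circle_openE => oW.
have qR : q%:~R != 0 :> R by rewrite intr_eq0.
pose g (m : int) (t : R) := (t - m%:~R) / q%:~R - s.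
have gc m : continuous (g m).
  move=> t; apply: cvgB; last exact: cvg_cst.
  apply: cvgM; last exact: cvg_cst.
  by apply: cvgB; [exact: cvg_id|exact: cvg_cst].
have -> : @circle_pi R @^-1` [set (x + circle_pi s) *~ q | x in W] =
    \bigcup_m (g m @^-1` (@circle_pi R @^-1` W)).
  apply/seteqP; split => [t [x Wx]|t [m _ Wm]] /=.
    have [u uE] := circle_pi_surj x; rewrite -uE -circle_piD -circle_piMz.
    move=> /esym/circle_pi_eq/intrP[m tm]; exists m => //=.
    have -> : g m t = u by rewrite /g -tm subKr mulrC mulKf // addrK.
    by rewrite uE.
  exists (circle_pi (g m t)) => //.
  rewrite -circle_piD -circle_piMz /g subrK mulrC divfK //.
  by rewrite -mulrNz circle_piDint.
by apply: bigcup_open => m _; apply: open_comp => // t _; exact: gc.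
Qed.

(** * Open sets contained in each other's closures *)

Lemma sub_closure_preimage {T : topologicalType} (f : T -> T) (V W : set T) :
  (forall O, open O -> open (f @^-1` O)) ->
  W `<=` closure (f @^-1` V) -> f @` W `<=` closure V.
Proof.
move=> fc WV _ [x /WV Vx <-]; apply: contrapT => nVfx.
have oN : open (f @^-1` ~` closure V).
  by apply: fc; exact/closed_openC/closed_closure.
have [z [Vz]] := Vx _ (open_nbhs_nbhs (conj oN nVfx)).
by apply; exact: subset_closure.
Qed.

(** Openness of [f] matters for one inclusion: if [W] is the interior of the
    closure of the preimage, then [f @` W] is an open set inside [closure V],
    hence inside the interior of [closure V], which is [V]. *)
Lemma regopen_preimage {T : topologicalType} (f : T -> T) (V : set T) :
  (forall O, open O -> open (f @^-1` O)) -> (forall W, open W -> open (f @` W)) ->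
  regopen V -> regopen (f @^-1` V).
Proof.
move=> fc fo rV.
have oV : open V by rewrite -rV; exact: open_interior.
apply/seteqP; split => x.
  move=> Ix; rewrite /preimage /= -rV; set W := _° in Ix.
  have oW : open (f @` W) by apply: fo; exact: open_interior.
  have fW : f @` W `<=` closure V.
    by apply: sub_closure_preimage => //; exact: interior_subset.
  by move: fW; rewrite (open_subsetE _ oW); apply; exists x.
by move: x; rewrite -/(subset _ _) -(open_subsetE _ (fc _ oV)); exact: subset_closure.
Qed.

(** Otherwise the orbit would visit the nonempty open set of points of [A] off
    the closure of [B]. *)
Lemma dense_words_sub_closure {R : realType} (alpha : R) (A B : set (circle R))
    (x : circle R) :
  irrational alpha -> open A ->
  (forall n : int, A (x + circle_pi alpha *~ n) -> B (x + circle_pi alpha *~ n)) ->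
  A `<=` closure B.
Proof.
move=> airr oA AB z Az; apply: contrapT => nBz.
have oN : open (A `&` ~` closure B).
  by apply: openI => //; exact/closed_openC/closed_closure.
have [] := orbit_dense alpha _ x airr oN; first by exists z.
by move=> n [/AB Bn]; apply; exact: subset_closure.
Qed.

Lemma pair_dense_words_sub_closure {R : realType} (alpha beta : R)
    (U V : set (circle R)) (x y : circle R) :
  (forall k l m : int, k%:~R * alpha + l%:~R * beta = m%:~R ->
     k = 0 /\ l = 0) ->
  open U ->
  (forall n : int, U (x + circle_pi alpha *~ n) -> V (y + circle_pi beta *~ n)) ->
  U `<=` closure V.
Proof.
move=> indep oU UV z Uz; apply: contrapT => nVz.
have oN : open (~` closure V) by exact/closed_openC/closed_closure.
have [||n [/UV Vn]] := orbit_pair_dense alpha beta U _ x y indep oU oN.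
- by exists z.
- by exists z.
- by apply; exact: subset_closure.
Qed.

Lemma mutual_closure_agree {T : topologicalType} (A B : set T) :
  open A -> open B -> A `<=` closure B -> B `<=` closure A ->
  agree_off_boundary A B.
Proof.
move=> oA oB AB BA x; rewrite /boundary !(interior_id _).1 // => nA nB.
by split=> [/AB ?|/BA ?]; apply: contrapT => ?; [apply: nB|apply: nA].
Qed.

Lemma mutual_closure_regopen_eq {T : topologicalType} (A B : set T) :
  regopen A -> regopen B -> A `<=` closure B -> B `<=` closure A -> A = B.
Proof.
move=> rA rB AB BA; rewrite -rA -rB; congr (_°).
have clS (C D : set T) : C `<=` closure D -> closure C `<=` closure D.
  move=> CD; rewrite (closure_id (closure D)).1; last exact: closed_closure.
  exact: closure_subset.
by apply/seteqP; split; exact: clS.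
Qed.

(** * Words and their generating sets *)

Theorem mainTheorem1 (R : realType) (alpha beta : R)
    (U V : set (circle R)) (x0 y0 : circle R)
    (alpha_irr : irrational alpha) (beta_irr : irrational beta)
    (U_open : open U) (V_open : open V)
    (x0_avoids : avoids_boundary alpha U x0)
    (y0_avoids : avoids_boundary beta V y0)
    (same_word : word alpha U x0 = word beta V y0) :
  exists (p q : int) (delta : R),
    [/\ p != 0, q != 0, 0 < delta,
        agree_off_boundary (multiply p U) (rotation delta @` multiply q V)
      & regopen U -> regopen V ->
        multiply p U = rotation delta @` multiply q V].
Proof.
have same n : U (x0 + circle_pi alpha *~ n) <-> V (y0 + circle_pi beta *~ n).
  have := congr1 (fun w => w n) same_word; rewrite /word !rotation_iterE.
  by do 2 case: ifPn => [/set_mem ?|/negP ?]; split=> // /mem_set.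
have mulE p : multiply p U = [set x | U ((x + 0) *~ p)].
  by apply/funext => x; rewrite /= addr0.
have mul_open p : open (multiply p U).
  by rewrite mulE; exact: affine_open_preimage.
have rot_open q delta : open (rotation delta @` multiply q V).
  by rewrite rotation_imageE; exact: affine_open_preimage.
suff [p [q [delta [p0 q0 delta0 AB BA]]]] : exists (p q : int) (delta : R),
    [/\ p != 0, q != 0, 0 < delta,
        multiply p U `<=` closure (rotation delta @` multiply q V) &
        rotation delta @` multiply q V `<=` closure (multiply p U)].
  exists p, q, delta; split => //; first exact: mutual_closure_agree.
  move=> rU rV; apply: mutual_closure_regopen_eq => //.
    rewrite mulE; apply: (regopen_preimage (fun x => (x + 0) *~ p)) => // O.
      exact: affine_open_preimage.
    exact: affine_open_image.
  rewrite rotation_imageE.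
  apply: (regopen_preimage (fun x => (x - circle_pi delta) *~ q)) => // O.
    exact: affine_open_preimage.
  exact: affine_open_image.
have [indep|] := pselect (forall k l m : int,
    k%:~R * alpha + l%:~R * beta = m%:~R -> k = 0 /\ l = 0).
  have indep' (l k m : int) : l%:~R * beta + k%:~R * alpha = m%:~R ->
    l = 0 /\ k = 0 by rewrite addrC => /indep[].
  have pi1 : circle_pi (1 : R) = 0.
    by have := circle_piDint (0 : R) 1; rewrite add0r => ->; exact: raddf0.
  have rot1 A : rotation 1 @` multiply 1 A = A :> set (circle R).
    rewrite rotation_imageE; apply/funext => x.
    by rewrite /multiply /= pi1 subr0.
  exists 1, 1, 1; rewrite rot1; split => //.
    by apply: (pair_dense_words_sub_closure _ _ _ _ x0 y0 indep) => // n /same.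
  by apply: (pair_dense_words_sub_closure _ _ _ _ y0 x0 indep') => // n /same.
move=> /existsNP[k /existsNP[l /existsNP[m /not_implyP[rel kl0]]]].
have l0 : l != 0.
  apply: contra_notN kl0 => /eqP l0; move: rel; rewrite l0 mul0r addr0.
  by move/(irrational_int_mul alpha_irr).
have k0 : k != 0.
  apply: contra_notN kl0 => /eqP k0; move: rel; rewrite k0 mul0r add0r.
  by move/(irrational_int_mul beta_irr).
have nk0 : - k != 0 by rewrite oppr_eq0.
have [x xE] := circle_divisible l x0 l0.
have [y yE] := circle_divisible (- k) y0 nk0.
have [delta delta0 deltaE] := circle_pi_pos_lift (x - y).
exists l, (- k), delta.
(* The rotation by alpha, multiplied by - k, is l steps of the rotation by beta. *)
have relC : circle_pi alpha *~ (- k) = circle_pi beta *~ l.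
  rewrite -!circle_piMz; apply/circle_pi_eq.
  rewrite mulrNz mulNr -opprD rel -mulrNz; exact: intr_int.
have orbitP n : multiply l U (x + circle_pi alpha *~ n) <->
    (rotation delta @` multiply (- k) V) (x + circle_pi alpha *~ n).
  rewrite rotation_imageE /multiply /= deltaE.
  have -> : x + circle_pi alpha *~ n - (x - y) = y + circle_pi alpha *~ n.
    by rewrite opprB addrC addrA subrK.
  rewrite !mulrzDl xE yE -!mulrzA [n * - k]mulrC [in X in _ <-> X]mulrzA relC.
  by rewrite -mulrzA [n * l]mulrC; exact: same.
split => //.
  by apply: (dense_words_sub_closure alpha _ _ x) => // n /orbitP.
by apply: (dense_words_sub_closure alpha _ _ x) => // n /orbitP.
Qed.
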